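(* Let $q$ be a prime power. Let $\mathcal{D}(q-1)$ be the lattice of positive divisors of $q-1$ (ordered by divisibility), and let $\mathcal{X}(q)$ be the interval $[\langle\{x_1\cdots x_q\}\rangle,\langle\{x_1x_2\}\rangle]$ of the lattice of monomial clones on $\mathbb{F}_q$ (ordered by inclusion). Let $\mathcal{C}\colon \mathcal{D}(q-1)\to\mathcal{X}(q)$, $\mathcal{C}(a):=\langle\{x_1\cdots x_{a+1}\}\rangle$. Then for all $a,b\in\mathcal{D}(q-1)$: $b\mid a$ if and only if $\mathcal{C}(a)\subseteq\mathcal{C}(b)$. Furthermore, $\mathcal{C}$ is surjective, and thus $\mathcal{C}$ is a dual lattice isomorphism (lattice anti-isomorphism) from $\mathcal{D}(q-1)$ to $\mathcal{X}(q)$.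
   Context: $\mathbb{N}=\{1,2,\dots\}$, $\mathbb{N}_0=\mathbb{N}\cup\{0\}$, $\mathbb{F}_q$ is the field with $q$ elements. A monomial is a formal product $g=\prod_{i\in\mathbb{N}}x_i^{\alpha(i)}$ with $\alpha(i)\in\mathbb{N}_0$, finitely many but at least one $\alpha(i)$ nonzero (so $1$ is not a monomial); $\mathrm{mI}(g)$ is the largest $i$ with $\alpha(i)\neq0$, called the arity of $g$. For $n\ge\mathrm{mI}(g)$ the $n$-ary induced function is $g^{\mathbb{F}_q^n}\colon\mathbb{F}_q^n\to\mathbb{F}_q$, $(x_1,\dots,x_n)\mapsto\prod_{i=1}^nx_i^{\alpha(i)}$. Monomials $m_1,m_2$ are equivalent if the $\mathrm{mI}(m_1)$-ary induced function of $m_1$ equals the $\mathrm{mI}(m_2)$-ary induced function of $m_2$ (i.e. for each $i$ the exponents of $x_i$ in $m_1$ and $m_2$ are equal, or both positive and congruent modulo $q-1$). A clone on a set $A$ is a set of finitary operations on $A$ (of arities $\ge1$) containing all projections and closed under composition. A set $M$ of monomials is a monomial clone on $\mathbb{F}_q$ if $\{m^{\mathbb{F}_q^n}\mid m\in M,\ n\ge\mathrm{mI}(m)\}$ is a clone on $\mathbb{F}_q$ and $M$ is closed under equivalent monomials. For a set $M'$ of monomials, $\langle M'\rangle$ is the least monomial clone on $\mathbb{F}_q$ containing $M'$. The set $\mathbb{M}_q$ of all monomial clones on $\mathbb{F}_q$, ordered by inclusion, is a lattice with meet $\cap$ and join $C\vee D$ the smallest monomial clone containing $C$ and $D$. *)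

(* Defs.v *)
From mathcomp Require Import all_boot all_algebra.
From mathcomp Require Import finmap monalg.
From mathcomp Require Import boolp classical_sets functions.

Set Implicit Arguments.
Unset Strict Implicit.
Unset Printing Implicit Defensive.

Import GRing.Theory.

Local Open Scope classical_set_scope.

(* Indices are shifted by one: exponent [i] of a monomial, and coordinate [i]
   of an argument tuple, belong to the variable usually written x_(i+1). *)

(* The unit 1 is not a monomial. *)
Definition monomial := {m : {cmonom nat} | m != mone}.

Definition expo (m : monomial) (i : nat) : nat := (val m : {cmonom nat}) i.

(* mI(m): the number of the last variable occurring in m; the .+1 undoes the
   index shift. *)
Definition mI (m : monomial) : nat :=
  \max_(i <- finsupp (val m : {cmonom nat})) i.+1.

Fact linmon_subproof (n : nat) :
  \big[mmul/mone]_(i < n.+1) (ucm (i : nat) : {cmonom nat}) != mone.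
Proof.
apply/eqP => /(congr1 (fun m : {cmonom nat} => m 0)).
by rewrite big_ord_recl cmM cmU cm1.
Qed.

(* x_1 x_2 ... x_(n+1); there are n+1 factors, since the empty product is not
   a monomial. *)
Definition linmon (n : nat) : monomial :=
  exist (fun m : {cmonom nat} => m != mone) _ (linmon_subproof n).

Section Clones.
Variable A : Type.

(* A set of finitary operations is given by its n-ary parts, n : nat. *)
Definition opset := forall n : nat, set (('I_n -> A) -> A).

(* There are no operations of arity 0; hence, in the composition clause,
   k and n are automatically positive. *)
Definition is_clone (C : opset) : Prop :=
  [/\ C 0 = set0,
      forall (n : nat) (i : 'I_n), C n (fun x => x i)
    & forall (k n : nat) (f : ('I_k -> A) -> A) (g : 'I_k -> ('I_n -> A) -> A),
        C k f -> (forall j, C n (g j)) -> C n (fun x => f (fun j => g j x))].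

End Clones.

Section MonomialClones.
Variable F : finFieldType.

(* The n-ary induced function, provided mI m <= n. *)
Definition induced (n : nat) (m : monomial) : ('I_n -> F) -> F :=
  fun x => (\prod_(i < n) x i ^+ expo m i)%R.
Arguments induced n m : clear implicits.

Definition induced_ops (M : set monomial) : opset F :=
  fun n => [set induced n m | m in [set m | M m /\ mI m <= n]].

(* The mI(m1)-ary function of m1 is the mI(m2)-ary function of m2; in
   particular their arities agree. *)
Definition equivalent (m1 m2 : monomial) : Prop :=
  mI m1 = mI m2 /\ induced (mI m1) m1 = induced (mI m1) m2.

Definition monomial_clone (M : set monomial) : Prop :=
  is_clone (induced_ops M) /\
  (forall m1 m2, equivalent m1 m2 -> M m1 -> M m2).

Definition clone_gen (M : set monomial) : set monomial :=
  \bigcap_(C in [set C | monomial_clone C /\ M `<=` C]) C.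

(* The meet of monomial clones is their intersection [`&`]. *)
Definition clone_join (C D : set monomial) : set monomial :=
  clone_gen (C `|` D).

Definition clone_interval (lo hi : set monomial) : set (set monomial) :=
  [set C | [/\ monomial_clone C, lo `<=` C & C `<=` hi]].

Definition clone_of_div (a : nat) : set monomial := clone_gen [set linmon a].

End MonomialClones.

(* gcdn and lcmn are the meet and join of this lattice. *)
Definition divisor_set (n : nat) : set nat := [set d | 0 < d /\ d %| n].

(* Main.v *)
Require Import Defs.
From mathcomp Require Import all_boot all_algebra.
From mathcomp Require Import cyclic finfield finmap monalg.
From mathcomp Require Import boolp classical_sets functions.

(** Every clone in the interval is determined by degrees.  For a divisor [a] of
    [q - 1], with [q = #|F|], let [degclass a] be the set of the monomials of
    total degree congruent to 1 modulo [a].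

    It is a monomial clone ([degclass_clone]): substituting monomials of degree
    1 modulo [a] into a monomial of degree 1 modulo [a] gives degree 1 again,
    and equivalent monomials have degrees congruent modulo [q - 1]
    ([deg_equivalent]), as one sees by evaluating at the constant tuple of a
    primitive root.  It is generated by x_1 ... x_(a+1) ([clone_of_divE]):
    nesting this monomial in itself gives all x_1 ... x_(ta+1), and identifying
    variables in these gives every monomial of degree [ta + 1].

    Conversely, let [M] be a monomial clone containing x_1 ... x_q.  Then
    membership in [M] depends only on the degree modulo [q - 1]
    ([clone_deg_mod]), and the set of the [e] with x_1 ... x_(e+1) in [M] is
    closed under addition ([clone_linmonD]).  So it corresponds to a submonoid
    of the finite cyclic group Z/(q-1), hence to a subgroup, and is the set of
    the multiples of some divisor [a] of [q - 1]; that is,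
    [M = degclass a] ([clone_degclass]).

    The map from divisors to clones is thus onto, and as
    [degclass a `<=` degclass b] means [b %| a] ([degclass_subset]), it
    reverses the order and exchanges meets and joins. *)

Import GRing.Theory.

Local Open Scope classical_set_scope.

(** * Degrees and exponents of monomials *)

Definition deg (m : monomial) : nat := mdeg (val m).

Lemma mI_leP (m : monomial) (n : nat) :
  reflect (forall i, n <= i -> expo m i = 0) (mI m <= n).
Proof.
apply: (iffP (bigmax_leqP_seq _ _ _ _)) => [le_n i le_ni | expo0 i im _].
  apply/eqP; rewrite -[_ == 0]negbK; apply/negP; rewrite cmE_neq0 => im.
  by have := le_n i im isT; rewrite ltnNge le_ni.
rewrite ltnNge; apply/negP => /expo0 /eqP.
by rewrite cmE_eq0 im.
Qed.

Lemma expo_eq0 {m : monomial} {i : nat} : mI m <= i -> expo m i = 0.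
Proof. by move=> le_mi; apply: (mI_leP m (mI m) _) => //. Qed.

Lemma deg_sum (m : monomial) (n : nat) :
  mI m <= n -> deg m = \sum_(i < n) expo m i.
Proof.
move=> le_mn; rewrite /deg (@mdegEw _ _ [fset i | i in iota 0 n]%fset).
  rewrite (perm_big (iota 0 n)) /=; last first.
    apply: uniq_perm; rewrite ?fset_uniq ?iota_uniq // => i.
    by rewrite in_fset.
  by rewrite -(big_mkord xpredT (fun i => expo m i)) /index_iota subn0.
apply/fsubsetP => i; rewrite -cmE_neq0 in_fset /= mem_iota /= add0n.
by apply: contraR; rewrite -leqNgt => le_ni; apply/eqP/(mI_leP m n).
Qed.

Lemma deg_gt0 (m : monomial) : 0 < deg m.
Proof. by rewrite lt0n mdeg_eq0 (valP m). Qed.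

Lemma mI_gt0 (m : monomial) : 0 < mI m.
Proof.
rewrite lt0n; apply/eqP => mI0; have := deg_gt0 m.
by rewrite (deg_sum m 0) ?big_ord0 // mI0.
Qed.

Lemma exists_expo_gt0 (m : monomial) : exists i, 0 < expo m i.
Proof.
apply: contrapT => /forallNP expo0; have := deg_gt0 m.
rewrite (deg_sum _ _ (leqnn _)) big1 // => i _.
by apply/eqP; rewrite -leqn0 leqNgt; apply/negP/expo0.
Qed.

(** A monomial of degree [d] arises from x_1 ... x_d by substituting for the
    factors the letters of such a word. *)
Lemma exists_word (m : monomial) :
  exists s : seq nat, forall i, count_mem i s = expo m i.
Proof.
exists (flatten [seq nseq (expo m i) i | i <- iota 0 (mI m)]) => i.
rewrite count_flatten -map_comp sumnE big_map.
under eq_bigr => j _ do rewrite /= count_nseq /=.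
case: (ltnP i (mI m)) => [lt_im | le_mi].
  rewrite (bigD1_seq i) ?iota_uniq ?mem_iota //= eqxx mul1n big1 ?addn0 //.
  by move=> j /negPf ->.
rewrite (expo_eq0 le_mi) big1_seq // => j /andP[_]; rewrite mem_iota /= add0n.
by case: (eqVneq j i) => // ->; rewrite ltnNge le_mi.
Qed.

(** Both sides count the pairs of a variable and an occurrence of it. *)
Lemma size_word (m : monomial) (s : seq nat) :
  (forall i, count_mem i s = expo m i) -> size s = deg m.
Proof.
move=> s_m; rewrite (deg_sum _ _ (leqnn _)).
under eq_bigr => i _ do rewrite -s_m -sum1_count.
rewrite -sum1_size (exchange_big_dep xpredT) //=.
rewrite [LHS]big_seq [RHS]big_seq.
apply: eq_bigr => j js; rewrite sum1_card.
have lt_jm : j < mI m.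
  rewrite ltnNge; apply/negP => /expo_eq0; rewrite -s_m => /eqP.
  by rewrite -leqn0 leqNgt -has_count has_pred1 js.
rewrite (@eq_card1 _ (Ordinal lt_jm)) // => i.
by rewrite !inE /= eq_sym.
Qed.

Lemma expo_linmon (n i : nat) : expo (linmon n) i = (i <= n).
Proof.
rewrite /expo /= (big_morph (fun m : {cmonom nat} => m i) (cmM i) (cm1 i)).
under eq_bigr => j _ do rewrite cmU.
rewrite -ltnS; case: (ltnP i n.+1) => [lt_in | lt_ni].
  rewrite (bigD1 (Ordinal lt_in)) //= eqxx big1 ?addn0 // => j.
  by rewrite -val_eqE /= => /negPf ->.
by rewrite big1 // => j _; rewrite ltn_eqF // (leq_trans (ltn_ord j)).
Qed.

Lemma deg_linmon (n : nat) : deg (linmon n) = n.+1.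
Proof.
rewrite /deg mdeg_prod; under eq_bigr => i _ do rewrite mdegU.
by rewrite sum1_card card_ord.
Qed.

Lemma mI_linmon (n : nat) : mI (linmon n) = n.+1.
Proof.
apply/eqP; rewrite eqn_leq; apply/andP; split.
  by apply/mI_leP => i lt_ni; rewrite expo_linmon leqNgt lt_ni.
by rewrite ltnNge; apply/negP => /expo_eq0; rewrite expo_linmon leqnn.
Qed.

Fact monvar_subproof (i : nat) : ucm i != mone.
Proof. by rewrite cm1_eq1. Qed.

Definition monvar (i : nat) : monomial :=
  exist (fun m : {cmonom nat} => m != mone) _ (monvar_subproof i).

Lemma expo_monvar (i j : nat) : expo (monvar i) j = (i == j).
Proof. exact: cmU. Qed.

Lemma deg_monvar (i : nat) : deg (monvar i) = 1.
Proof. exact: mdegU. Qed.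

Lemma mI_monvar (i : nat) : mI (monvar i) <= i.+1.
Proof. by apply/mI_leP => j lt_ij; rewrite expo_monvar ltn_eqF. Qed.

(** The monomial obtained from [m] by putting [h j] for the variable of
    index [j]; its exponents are given by [expo_subst]. *)
Definition subst_cmonom (m : monomial) (h : nat -> monomial) : {cmonom nat} :=
  \big[mmul/mone]_(j < mI m) \big[mmul/mone]_(l < expo m j) val (h j).

Lemma mdeg_subst (m : monomial) (h : nat -> monomial) :
  mdeg (subst_cmonom m h) = \sum_(j < mI m) expo m j * deg (h j).
Proof.
rewrite mdeg_prod; apply: eq_bigr => j _.
by rewrite mdeg_prod sum_nat_const card_ord.
Qed.

Fact subst_subproof (m : monomial) (h : nat -> monomial) :
  subst_cmonom m h != mone.
Proof.
rewrite -mdeg_eq0 -lt0n mdeg_subst (leq_trans (deg_gt0 m)) //.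
rewrite (deg_sum _ _ (leqnn _)) leq_sum // => j _.
by rewrite leq_pmulr ?deg_gt0.
Qed.

Definition subst (m : monomial) (h : nat -> monomial) : monomial :=
  exist (fun m : {cmonom nat} => m != mone) _ (subst_subproof m h).

Lemma deg_subst (m : monomial) (h : nat -> monomial) :
  deg (subst m h) = \sum_(j < mI m) expo m j * deg (h j).
Proof. exact: mdeg_subst. Qed.

Lemma expo_subst (m : monomial) (h : nat -> monomial) (i : nat) :
  expo (subst m h) i = \sum_(j < mI m) expo m j * expo (h j) i.
Proof.
have expoM := big_morph (fun m : {cmonom nat} => m i) (cmM i) (cm1 i).
rewrite /expo /= expoM; apply: eq_bigr => j _.
by rewrite expoM sum_nat_const card_ord.
Qed.

(** * Induced functions and equivalence *)

Section InducedFunctions.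
Variable F : finFieldType.

Lemma card_pred_gt0 : 0 < #|F|.-1.
Proof. by have := finNzRing_gt1 F; case: #|F| => [|[]]. Qed.

(** Iterating [x ^+ #|F| = x]; positivity of the exponent is what makes this
    hold at [x = 0] too. *)
Lemma expf_addM (x : F) (e c : nat) :
  0 < e -> (x ^+ (e + #|F|.-1 * c) = x ^+ e)%R.
Proof.
move=> e_gt0; elim: c => [|c IHc]; first by rewrite muln0 addn0.
rewrite mulnS addnCA -[in RHS]IHc.
case: (e + _) (ltn_addr (#|F|.-1 * c) e_gt0) => // d _.
rewrite addnS -addSn prednK ?exprD ?expf_card ?exprS //.
exact: ltnW (finNzRing_gt1 F).
Qed.

Lemma exists_prim_root : exists g : F, #|F|.-1.-primitive_root%R g.
Proof.
pose rs := filter (predC1 (0%R : F)) (enum F).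
suff /hasP[g _ ?] : has #|F|.-1.-primitive_root%R rs by exists g.
apply: has_prim_root; first exact: card_pred_gt0.
- apply/allP => x; rewrite mem_filter => /andP[x0 _].
  apply/unity_rootP; apply: (mulfI x0).
  by rewrite -exprS prednK ?expf_card ?mulr1 // ltnW ?finNzRing_gt1.
- by rewrite filter_uniq ?enum_uniq.
by rewrite /rs -rem_filter ?enum_uniq // size_rem ?mem_enum // cardE.
Qed.

(** On the constant tuple of a primitive root [g], the induced function takes
    the value [g ^+ deg m], which determines [deg m] modulo [#|F|.-1]. *)
Lemma deg_equivalent (m1 m2 : monomial) :
  equivalent F m1 m2 -> deg m1 = deg m2 %[mod #|F|.-1].
Proof.
move=> [eqI eqf]; have [g prim_g] := exists_prim_root.
apply/eqP; rewrite -(eq_prim_root_expr prim_g) (deg_sum m1 _ (leqnn _)).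
rewrite (deg_sum m2 (mI m1)) ?eqI // -eqI !expr_sum.
by have /(congr1 (fun f => f (fun=> g))) /eqP := eqf.
Qed.

(** Added variables are given the value 1, whatever exponents [m] has there. *)
Lemma induced_extend (k n : nat) (m : monomial) (x : 'I_k -> F) : k <= n ->
  @induced F k m x =
  @induced F n m (fun j => if insub (j : nat) is Some i then x i else 1%R).
Proof.
move=> le_kn.
pose G j := ((if insub j is Some i then x i else 1) ^+ expo m j)%R.
transitivity (\prod_(i < k) G i)%R.
  by apply: eq_bigr => i _; rewrite /G valK.
rewrite (big_ord_widen _ _ le_kn) big_mkcond /=; apply: eq_bigr => i _.
by rewrite /G; case: ifP => //; case: insubP => [? ->|_ _] //; rewrite expr1n.
Qed.

(** Such a tuple detects whether the variable [i] occurs in [m]. *)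
Lemma induced_axis (n : nat) (m : monomial) (i : 'I_n) :
  @induced F n m (fun j => (j != i)%:R%R) = (expo m i == 0)%:R%R.
Proof.
rewrite /induced (bigD1 i) //= eqxx big1 ?mulr1; first by rewrite expr0n.
by move=> j ->; rewrite expr1n.
Qed.

(** Equivalence can be tested at any arity large enough for both monomials.  The
    point is that the induced function determines which variables occur, hence
    the arity of the monomial. *)
Lemma equivalent_induced (n : nat) (m1 m2 : monomial) :
    mI m1 <= n -> mI m2 <= n -> @induced F n m1 = induced m2 ->
  equivalent F m1 m2.
Proof.
move=> le1 le2 eqf.
have expo0 i : (expo m1 i == 0) = (expo m2 i == 0).
  case: (ltnP i n) => [lt_in | le_ni]; last first.
    by rewrite (mI_leP m1 n le1) // (mI_leP m2 n le2).
  have /eqP := congr1 (fun f => f (fun j => (j != Ordinal lt_in)%:R%R)) eqf.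
  rewrite !induced_axis /=.
  by do 2!case: (_ == 0); rewrite ?eqxx ?oner_eq0 ?[0%R == _]eq_sym ?oner_eq0.
have eqI : mI m1 = mI m2.
  apply/eqP; rewrite eqn_leq; apply/andP.
  split; apply/mI_leP => i /expo_eq0 /eqP; first by rewrite -expo0 => /eqP.
  by rewrite expo0 => /eqP.
split=> //; apply: funext => x.
by rewrite !(induced_extend _ _ _ x le1) eqf.
Qed.

Lemma induced_comp (k n : nat) (m : monomial) (h : nat -> monomial)
    (x : 'I_n -> F) : mI m <= k ->
  @induced F k m (fun j => induced (h j) x) =
  (\prod_(i < n) x i ^+ (\sum_(j < mI m) expo m j * expo (h j) i)%N)%R.
Proof.
move=> le_mk; under eq_bigr => i _ do rewrite expr_sum.
rewrite exchange_big /induced /=.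
pose G j := (\prod_(i < n) x i ^+ (expo m j * expo (h j) i)%N)%R.
rewrite (big_ord_widen _ G le_mk) {}/G.
rewrite [RHS]big_mkcond; apply: eq_bigr => j _.
case: ltnP => [_ | /expo_eq0 -> //].
by rewrite -prodrXl; apply: eq_bigr => i _; rewrite -exprM mulnC.
Qed.

(** A monomial clone can be handled through its operations alone: an operation
    may come from another monomial of [M], but then an equivalent one. *)
Lemma clone_mem_induced (M : set monomial) (n : nat) (m : monomial) :
    monomial_clone F M -> mI m <= n -> @induced_ops F M n (induced m) -> M m.
Proof.
move=> [_ Meq] le_mn [m1 [Mm1 le1] eqf].
by apply: Meq Mm1; apply: equivalent_induced eqf.
Qed.

Lemma induced_monvar (n : nat) (i : 'I_n) :
  @induced F n (monvar i) = (fun x => x i).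
Proof.
apply: funext => x; rewrite /induced (bigD1 i) //= expo_monvar eqxx expr1.
rewrite big1 ?mulr1 // => j ne_ji.
by rewrite expo_monvar eq_sym (negPf ne_ji : (j == i :> nat) = _) expr0.
Qed.

Lemma clone_monvar (M : set monomial) (i : nat) :
  monomial_clone F M -> M (monvar i).
Proof.
move=> MC; have [[_ Mproj _] _] := MC.
apply: (clone_mem_induced _ _ _ MC (mI_monvar i)).
rewrite -[i]/(val (Ordinal (ltnSn i))) induced_monvar.
exact: Mproj.
Qed.

(** Closure under composition, in terms of exponents.  The result [m'] need
    only have the right exponents as power maps on [F]. *)
Lemma clone_comp (M : set monomial) (m m' : monomial) (h : nat -> monomial) :
    monomial_clone F M -> M m -> (forall j, j < mI m -> M (h j)) ->
    (forall i (x : F),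
       x ^+ expo m' i = x ^+ (\sum_(j < mI m) expo m j * expo (h j) i)%N)%R ->
  M m'.
Proof.
move=> MC Mm Mh eq_e; have [[_ _ Mcomp] _] := MC.
pose n := maxn (mI m') (\max_(j < mI m) mI (h j)).
apply: (clone_mem_induced M n) => //; first exact: leq_maxl.
have -> : induced m' = (fun x : 'I_n -> F =>
    @induced F (mI m) m (fun j => induced (h j) x)).
  apply: funext => x; rewrite induced_comp //.
  by apply: eq_bigr => i _; rewrite eq_e.
apply: (Mcomp _ _ (@induced F _ m) (fun j => @induced F n (h j))).
  by exists m.
move=> j; exists (h j) => //; split; first exact: Mh.
apply: leq_trans (leq_maxr _ _).
exact: (leq_bigmax (F := fun j : 'I_(mI m) => mI (h j))).
Qed.

Lemma clone_subst (M : set monomial) (m : monomial) (h : nat -> monomial) :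
    monomial_clone F M -> M m -> (forall j, j < mI m -> M (h j)) ->
  M (subst m h).
Proof.
move=> MC Mm Mh; apply: (clone_comp M m _ h) => // i x.
by rewrite expo_subst.
Qed.

End InducedFunctions.

(** * The clones defined by a degree congruence *)

Definition degclass (a : nat) : set monomial := [set m | deg m = 1 %[mod a]].

Lemma degclassP (a : nat) (m : monomial) : degclass a m <-> a %| (deg m).-1.
Proof.
rewrite /degclass /=; have := deg_gt0 m; case: (deg m) => // d _ /=.
rewrite /dvdn -[in _ %% a == 0](mod0n a) -(eqn_modDl 1) addn0 add1n.
by split=> /eqP.
Qed.

Lemma degclass_linmon (a n : nat) : degclass a (linmon n) <-> a %| n.
Proof. by rewrite degclassP deg_linmon. Qed.

Section ClonesFromDegrees.
Variable F : finFieldType.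

Lemma degclass_clone (a : nat) : a %| #|F|.-1 -> monomial_clone F (degclass a).
Proof.
move=> a_dvd; split; last first.
  move=> m1 m2 /deg_equivalent eq_deg; rewrite /degclass /= => <-.
  by rewrite -(modn_dvdm (deg m2) a_dvd) -eq_deg modn_dvdm.
split.
- by rewrite -subset0 => f [m [_ m0] _]; have := mI_gt0 m; rewrite ltnNge m0.
- move=> n i; exists (monvar i); last exact: induced_monvar.
  split; first by rewrite /degclass /= deg_monvar.
  exact: leq_trans (mI_monvar i) (ltn_ord i).
move=> k n f g [m [am le_mk] <-] g_a.
(* [inord] below needs the arity to be a successor. *)
have k_gt0 : 0 < k := leq_trans (mI_gt0 m) le_mk.
case: k k_gt0 f g le_mk g_a => // k _ _ g le_mk g_a.
have /choice[h g_h] : forall j : nat, exists m' : monomial,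
    (degclass a m' /\ mI m' <= n) /\ induced m' = g (inord j).
  by move=> j; have [m' am' eq_g] := g_a (inord j); exists m'.
exists (subst m h); last first.
  apply: funext => x; have -> : (fun j => g j x) = (fun j => induced (h j) x).
    by apply: funext => j; rewrite (g_h j).2 inord_val.
  by rewrite induced_comp //; apply: eq_bigr => i _; rewrite expo_subst.
split; last first.
  apply/mI_leP => i le_ni; rewrite expo_subst big1 // => j _.
  by rewrite (mI_leP (h j) n (g_h j).1.2) // muln0.
rewrite /degclass /= deg_subst -modn_summ.
under eq_bigr => j _ do rewrite -modnMmr (g_h j).1.1 modnMmr muln1.
by rewrite modn_summ -deg_sum.
Qed.

(** Closure under products of [n.+1] factors.  Most of these factors will be
    variables, which lie in every clone. *)
Lemma clone_prod (M : set monomial) (n : nat) (s : seq monomial)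
    (m : monomial) :
    monomial_clone F M -> M (linmon n) -> size s = n.+1 ->
    (forall g, g \in s -> M g) ->
    (forall i (x : F),
       x ^+ expo m i = x ^+ (\sum_(g <- s) expo g i)%N)%R ->
  M m.
Proof.
move=> MC Mn size_s Ms eq_e.
apply: (clone_comp _ M (linmon n) m (nth (monvar 0) s) MC Mn).
  by move=> j; rewrite mI_linmon -size_s => lt_js; apply/Ms/mem_nth.
move=> i x; rewrite eq_e (big_nth (monvar 0)) big_mkord size_s mI_linmon.
congr (_ ^+ _)%R; apply: eq_bigr => j _.
by rewrite expo_linmon -ltnS ltn_ord mul1n.
Qed.

Lemma sum_expo_monvar (w : seq nat) (i : nat) :
  \sum_(g <- [seq monvar j | j <- w]) expo g i = count_mem i w.
Proof.
rewrite big_map -sum1_count [RHS]big_mkcond; apply: eq_bigr => j _ /=.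
by rewrite expo_monvar; case: eqP.
Qed.

Lemma mem_monvar (M : set monomial) (w : seq nat) (g : monomial) :
  monomial_clone F M -> g \in [seq monvar j | j <- w] -> M g.
Proof. by move=> MC /mapP[j _ ->]; apply: clone_monvar MC. Qed.

(** Put x_1 ... x_(b+1) for the first factor of a product of [a.+1] factors, and
    fresh variables for the other [a]. *)
Lemma clone_linmonD (M : set monomial) (a b : nat) :
    monomial_clone F M -> M (linmon a) -> M (linmon b) ->
  M (linmon (a + b)).
Proof.
move=> MC Ma Mb.
apply: (clone_prod _ a (linmon b :: [seq monvar j | j <- iota b.+1 a])) => //.
- by rewrite /= size_map size_iota.
- by move=> g; rewrite inE => /predU1P[-> // | /mem_monvar]; apply.
move=> i x; rewrite big_cons sum_expo_monvar !expo_linmon.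
rewrite count_uniq_mem ?iota_uniq // mem_iota addSn ltnS [b + a]addnC.
case: (leqP i b) => [le_ib | _]; last by [].
by rewrite (leq_trans le_ib (leq_addl _ _)).
Qed.

Lemma clone_linmonM (M : set monomial) (a t : nat) :
  monomial_clone F M -> M (linmon a) -> M (linmon (t * a)).
Proof.
move=> MC Ma; elim: t => [|t IHt]; last by rewrite mulSn; apply: clone_linmonD.
rewrite mul0n (_ : linmon 0 = monvar 0); first exact: clone_monvar MC.
by apply: val_inj; rewrite /= big_ord_recl big_ord0 mulm1.
Qed.

Lemma clone_of_deg (M : set monomial) (n : nat) (m : monomial) :
  monomial_clone F M -> M (linmon n) -> deg m = n.+1 -> M m.
Proof.
move=> MC Mn deg_m; have [w m_w] := exists_word m.
apply: (clone_prod _ n [seq monvar j | j <- w]) => //.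
- by rewrite size_map (size_word m).
- by move=> g; apply: mem_monvar.
by move=> i x; rewrite sum_expo_monvar m_w.
Qed.

Lemma degclass_sub (M : set monomial) (a : nat) :
  monomial_clone F M -> M (linmon a) -> degclass a `<=` M.
Proof.
move=> MC Ma m /degclassP /dvdnP[t def_t].
apply: (clone_of_deg M (deg m).-1) => //; last by rewrite prednK ?deg_gt0.
by rewrite def_t; apply: clone_linmonM.
Qed.

(** Let [d := deg m] and [x] a variable of [m'].  Identifying all variables
    of [m] puts x^d in [M].  It remains to multiply x^d by a number of variables
    divisible by [q - 1] so as to get a monomial equivalent to [m']: take
    (q - 2)d times [x] and the letters of [m'].  The outcome is
    x^((q - 1)d) m', and the first factor does not change the induced function,
    as [x] occurs in [m']. *)
Lemma clone_deg_mod (M : set monomial) (m m' : monomial) :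
    monomial_clone F M -> M (linmon #|F|.-1) -> M m ->
    deg m = deg m' %[mod #|F|.-1] ->
  M m'.
Proof.
move=> MC Mq Mm eq_deg; have [i0 e_gt0] := exists_expo_gt0 m'.
have [w m_w] := exists_word m'; set q1 := #|F|.-1 in Mq eq_deg *.
have q1_gt0 : 0 < q1 := card_pred_gt0 F.
pose w' := nseq (q1.-1 * deg m) i0 ++ w.
pose p := subst m (fun=> monvar i0).
have Mp : M p.
  by apply: (clone_subst _ _ _ _ MC Mm) => j _; apply: (clone_monvar _ _ _ MC).
have expo_p i : expo p i = (i0 == i) * deg m.
  rewrite expo_subst (deg_sum m _ (leqnn _)) big_distrr /=.
  by apply: eq_bigr => j _; rewrite expo_monvar mulnC.
have size_w' : q1 %| size w'.
  rewrite size_cat size_nseq (size_word m') // /dvdn -modnDmr -eq_deg modnDmr.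
  by rewrite -mulSnr prednK // modnMr.
have /dvdnP[t def_t] := size_w'.
apply: (clone_prod _ (t * q1) (p :: [seq monvar j | j <- w'])) => //.
- exact: clone_linmonM.
- by rewrite /= size_map def_t.
- by move=> g; rewrite inE => /predU1P[-> // | /mem_monvar]; apply.
move=> i x; rewrite big_cons sum_expo_monvar count_cat count_nseq m_w expo_p /=.
rewrite addnA; case: eqVneq => [<- | _]; last by rewrite !mul0n.
by rewrite !mul1n -mulSn prednK // addnC expf_addM.
Qed.

(** Take the least positive [a] with x_1 ... x_(a+1) in [M]; it remains to show
    that every degree in [M] is 1 modulo [a].  If some [m] in [M] has degree
    [e + 1], then x_1 ... x_(r+1) with [r := e %% a] is in [M] as well, which
    contradicts the choice of [a] unless [r = 0]. *)
Lemma clone_degclass (M : set monomial) :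
    monomial_clone F M -> M (linmon #|F|.-1) ->
  exists2 a, a %| #|F|.-1 & 0 < a /\ M = degclass a.
Proof.
move=> MC Mq.
have q1_gt0 := card_pred_gt0 F.
have ex_a : exists a, (0 < a) && `[< M (linmon a) >].
  by exists #|F|.-1; rewrite q1_gt0; apply/asboolP.
case: (ex_minnP ex_a) => a /andP[a_gt0 /asboolP Ma] min_a.
have deg_M m : M m -> degclass a m.
  move=> Mm; apply/degclassP; set e := (deg m).-1.
  have def_e : deg m = e.+1 by rewrite prednK ?deg_gt0.
  rewrite /dvdn -leqn0 leqNgt; apply/negP => r_gt0.
  suff Mr : M (linmon (e %% a)).
    have := min_a (e %% a); rewrite r_gt0 leqNgt ltn_pmod //=.
    by move=> le_ar; have /le_ar := asboolT Mr.
  have Me : M (linmon e).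
    by apply: (clone_deg_mod M m) => //; rewrite deg_linmon def_e.
  (* Modulo q - 1, adding (q - 2) times the multiple of a below e is the same as
     subtracting that multiple. *)
  have Mt := clone_linmonM _ _ (#|F|.-1.-1 * (e %/ a)) MC Ma.
  have := clone_linmonD _ _ _ MC Me Mt.
  move/(clone_deg_mod M _ _ MC Mq); apply; rewrite !deg_linmon.
  rewrite {1}(divn_eq e a) -mulnA addnAC -mulSn prednK //.
  by rewrite -addnS mulnC modnMDl.
exists a; first exact/degclass_linmon/deg_M.
split=> //; apply/seteqP; split; first exact: deg_M.
exact: degclass_sub.
Qed.

Lemma clone_of_divE (a : nat) :
  a %| #|F|.-1 -> clone_of_div F a = degclass a.
Proof.
move=> a_dvd; apply/seteqP; split=> m.
  apply; split; first exact: degclass_clone.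
  by move=> _ ->; apply/degclass_linmon.
by move=> am M [MC /(_ _ erefl) Ma]; apply: degclass_sub am.
Qed.

Lemma degclass_subset (a b : nat) : b %| a <-> degclass a `<=` degclass b.
Proof.
split=> [b_a m /degclassP am | ab].
  by apply/degclassP/(dvdn_trans b_a).
by apply/degclass_linmon/ab/degclass_linmon.
Qed.

End ClonesFromDegrees.

(** * The lattice anti-isomorphism *)

Theorem theorem5p4 (p k q : nat) (p_prime : prime p) (k_gt0 : 0 < k)
    (q_def : q = p ^ k) (F : finFieldType) (cardF : #|F| = q) :
  let D : set nat := divisor_set q.-1 in
  let C : nat -> set monomial := clone_of_div F in
  let X : set (set monomial) :=
    clone_interval F (clone_gen F [set linmon q.-1])
                     (clone_gen F [set linmon 1]) in
  [/\ set_bij D X C,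
      forall a b : nat, D a -> D b -> (b %| a <-> C a `<=` C b),
      forall a b : nat, D a -> D b -> C (gcdn a b) = clone_join F (C a) (C b)
    & forall a b : nat, D a -> D b -> C (lcmn a b) = C a `&` C b].
Proof.
rewrite -{}cardF => D C X.
have C_E a : D a -> C a = degclass a by case=> _; apply: clone_of_divE.
have q1_gt0 := card_pred_gt0 F.
have D1 : D 1 by split; rewrite ?dvd1n.
have Dq : D #|F|.-1 by split.
have C_sub a b : D a -> D b -> (b %| a <-> C a `<=` C b).
  by move=> Da Db; rewrite !C_E //; apply: degclass_subset.
have C_mon a : D a -> monomial_clone F (C a).
  by move=> Da; rewrite C_E //; apply: degclass_clone; case: Da.
have C_onto M : monomial_clone F M -> M (linmon #|F|.-1) ->
    exists2 a, D a & C a = M.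
  move=> MC /(clone_degclass F M MC)[a a_dvd [a_gt0 ->]].
  by exists a; [split | rewrite C_E].
split=> //.
- split.
  + move=> a Da; split; first exact: C_mon.
      by apply/C_sub => //; case: Da.
    by apply/C_sub => //; apply: dvd1n.
  + move=> a b /set_mem Da /set_mem Db eqC; apply/eqP; rewrite eqn_dvd.
    by apply/andP; split; apply/C_sub => //; rewrite eqC.
  + move=> M [MC lo _]; apply: C_onto => //; apply: lo.
    by move=> N [_]; apply.
- move=> a b Da Db.
  have Dg : D (gcdn a b).
    by split; [rewrite gcdn_gt0 Da.1 | apply: dvdn_trans (dvdn_gcdl _ _) Da.2].
  apply/seteqP; split; last first.
    move=> m; apply; split; first exact: C_mon.
    by rewrite subUset; split; apply/C_sub; rewrite ?dvdn_gcdl ?dvdn_gcdr.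
  (* A clone M containing C a and C b lies above the bottom of the interval, so
     it is C c for some c, and c divides both a and b. *)
  move=> m gm M [MC]; rewrite subUset => -[aM bM].
  have [c Dc def_M] : exists2 c, D c & C c = M.
    apply: C_onto => //; apply: aM.
    have aq : C #|F|.-1 `<=` C a by apply/C_sub => //; case: Da.
    by apply: aq => N [_]; apply.
  have /C_sub : c %| gcdn a b.
    by rewrite dvdn_gcd; apply/andP; split; apply/C_sub; rewrite ?def_M.
  by rewrite def_M; apply.
move=> a b Da Db.
have Dl : D (lcmn a b).
  by split; [rewrite lcmn_gt0 Da.1 Db.1 | rewrite dvdn_lcm Da.2 Db.2].
apply/seteqP; split.
  by rewrite subsetI; split; apply/C_sub; rewrite ?dvdn_lcml ?dvdn_lcmr.
rewrite !C_E // => m [/degclassP am /degclassP bm].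
by apply/degclassP; rewrite dvdn_lcm am bm.
Qed.
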